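(* For $n\ge 1$, let $g_{n,4}$ denote the number of standard Young tableaux of truncated shifted shape with $n$ rows and $4$ boxes in each row. Then $g_{n,4}=P_{2n-1}$, the $(2n-1)$-st Pell number, and consequently $$g_{n,4}=6g_{n-1,4}-g_{n-2,4}\quad (n\ge 3),\qquad g_{1,4}=1,\ g_{2,4}=5.$$
   Context: The truncated shifted shape with $n$ rows and $k$ boxes in each row is the set of boxes $(i,c)$ with $1\le i\le n$ and $i\le c\le i+k-1$ (row $i$ consists of $k$ consecutive boxes starting in column $i$). A standard Young tableau of this shape is a bijective labeling of its $nk$ boxes by $\{1,\dots,nk\}$ such that labels increase from left to right along each row and from top to bottom along each column. The Pell numbers are defined by $P_0=0$, $P_1=1$, $P_n=2P_{n-1}+P_{n-2}$. *)

(* Defs.v *)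
From mathcomp Require Import all_boot.

Set Implicit Arguments.
Unset Strict Implicit.
Unset Printing Implicit Defensive.

(* Rows, columns and labels are numbered from 0: the box (i, c) of the usual
   1-based description is (i - 1, c - 1) here.  The condition i <= c < i + k is
   unaffected by this shift, and every column index is < n + k, so that the ambient grid
   'I_n * 'I_(n + k) cuts nothing off. *)
Definition in_shape (n k : nat) (b : 'I_n * 'I_(n + k)) : bool :=
  b.1 <= b.2 < b.1 + k.

Notation box n k := {b : 'I_n * 'I_(n + k) | @in_shape n k b}.

Definition row_of (n k : nat) (b : box n k) : nat := (val b).1.
Definition col_of (n k : nat) (b : box n k) : nat := (val b).2.

(* A label l : 'I_(n * k) stands for l + 1 in {1, ..., n k}. *)
Definition bijective_labeling (n k : nat) (T : {ffun box n k -> 'I_(n * k)}) :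
    bool :=
  injectiveb T && [forall l, exists b, T b == l].

Definition row_increasing (n k : nat) (T : {ffun box n k -> 'I_(n * k)}) :
    bool :=
  [forall b1, forall b2,
    (row_of b1 == row_of b2) && (col_of b1 < col_of b2) ==> (T b1 < T b2)].

Definition col_increasing (n k : nat) (T : {ffun box n k -> 'I_(n * k)}) :
    bool :=
  [forall b1, forall b2,
    (col_of b1 == col_of b2) && (row_of b1 < row_of b2) ==> (T b1 < T b2)].

Definition syt (n k : nat) : {set {ffun box n k -> 'I_(n * k)}} :=
  [set T | [&& bijective_labeling T, row_increasing T & col_increasing T]].

Definition g (n k : nat) : nat := #|syt n k|.

Fixpoint pell (n : nat) : nat :=
  match n with
  | 0 => 0
  | m.+1 => if m is p.+1 then 2 * pell m + pell p else 1
  end.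

(* Main.v *)
(* Put the box in row i and column c on the diagonal c - i.  An order ideal of
   the shape is given by the numbers a_0 >= a_1 >= a_2 >= a_3 of its boxes on
   each diagonal, and the order says exactly that consecutive a_j differ by at
   most 1.  Removing the largest label of a tableau lowers one a_j by 1, so g n 4
   counts walks between such vectors.  Up to translation there are two vectors
   of each size mod 4; with x_k the count at (k,k,k,k) and y_k the count at
   (k+1,k,k,k-1), the recursion over one period reads
     x_{k+1} = x_k + 2 y_k,  y_{k+1} = 2 x_k + 5 y_k,
   which is two steps of the Pell recursion: x_k = P_{2k-1}, y_k = P_{2k}. *)
Require Import Defs.
From mathcomp Require Import all_boot all_order all_algebra.
From mathcomp Require Import zify.

Set Implicit Arguments.
Unset Strict Implicit.
Unset Printing Implicit Defensive.

(** * Linear extensions of a finite relation, counted by the position of the top label *)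

Section LinearExtensions.

Variables (B : finType) (lt : rel B) (M : nat) (d0 : 'I_M).
Implicit Types (S : {set B}) (T : {ffun B -> 'I_M}) (x y : B).

(* The value d0 outside S is a dummy: it lets the labelings of all subsets S
   share one type. *)
Definition lext S : {set {ffun B -> 'I_M}} :=
  [set T : {ffun B -> 'I_M} | [&& [forall x, if x \in S then T x < #|S| else T x == d0],
               [forall x in S, forall y in S, (T x == T y) ==> (x == y)]
             & [forall x in S, forall y in S, lt x y ==> (T x < T y)]]].

Lemma lextP S T :
  reflect [/\ {in S, forall x, T x < #|S|},
              forall x, x \notin S -> T x = d0,
              {in S &, injective T}
            & {in S &, forall x y, lt x y -> T x < T y}]
          (T \in lext S).
Proof.
rewrite inE; apply: (iffP and3P) => [[bT iT mT]|[bT oT iT mT]]; split.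
- by move=> x xS; have := forallP bT x; rewrite xS.
- by move=> x xS; have := forallP bT x; rewrite (negPf xS) => /eqP.
- move=> x y xS yS /eqP eT.
  by apply/eqP; have /forall_inP/(_ y yS)/implyP := forall_inP iT x xS; apply.
- by move=> x y xS yS; have /forall_inP/(_ y yS)/implyP := forall_inP mT x xS.
- by apply/forallP => x; case: ifPn => [/bT|/oT ->].
- apply/forall_inP => x xS; apply/forall_inP => y yS.
  by apply/implyP => /eqP /iT ->.
- apply/forall_inP => x xS; apply/forall_inP => y yS.
  by apply/implyP; apply: mT.
Qed.

Definition maximal_in S x := (x \in S) && [forall y in S, ~~ lt x y].

Lemma lext_set0 : #|lext set0| = 1.
Proof.
apply/eqP/cards1P; exists [ffun=> d0]; apply/setP => T; rewrite [RHS]inE.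
apply/lextP/eqP => [[_ oT _ _]|->].
  by apply/ffunP => x; rewrite ffunE oT // inE.
by split=> [x||x y|x y]; rewrite ?inE // => x; rewrite ffunE.
Qed.

(** By injectivity the labels on [S] fill all values below [#|S|], so the top one occurs exactly
    once. As a sum equal to 1 this can be inserted under the sum over [T] in [lext_rec] before
    exchanging the sums. *)
Lemma lext_top S T : T \in lext S -> S != set0 ->
  \sum_(x in S) (T x == #|S|.-1 :> nat) = 1.
Proof.
case/lextP=> bT _ iT _ S0; have S_gt0 : 0 < #|S| by rewrite card_gt0.
have [x xS Tx] : exists2 x, x \in S & T x = #|S|.-1 :> nat.
  have le_SM : #|S| <= M.
    by rewrite -(card_in_imset iT) -[M in _ <= M]card_ord max_card.
  have eqI : T @: S = [set l : 'I_M | l < #|S|].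
    apply/eqP; rewrite eqEcard; apply/andP; split.
      by apply/subsetP => _ /imsetP[x xS ->]; rewrite inE bT.
    rewrite (card_in_imset iT) -sum1dep_card.
    by rewrite -(big_ord_widen _ (fun=> 1) le_SM) sum1_card card_ord.
  have lt_M : #|S|.-1 < M by rewrite prednK.
  have : Ordinal lt_M \in T @: S by rewrite eqI inE /= prednK.
  by case/imsetP => x xS /(congr1 val) /= Tx; exists x.
rewrite (bigD1 x) //= Tx eqxx big1 // => y /andP[yS ne_yx].
case: eqP => // Ty; case/eqP: ne_yx; apply: iT => //.
by apply: val_inj; rewrite /= Ty.
Qed.

(** If [x] is maximal, erasing its top label is a bijection onto the labelings of [S :\ x];
    otherwise some element above [x] would need a label beyond the top one. *)
Lemma lext_fiber S x : #|S| <= M -> x \in S ->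
  \sum_(T in lext S) (T x == #|S|.-1 :> nat) =
  maximal_in S x * #|lext (S :\ x)|.
Proof.
move=> le_SM xS; rewrite /maximal_in xS /= [LHS]big_mkcond /=.
have cS : #|S| = #|S :\ x|.+1 by rewrite (cardsD1 x S) xS.
case: (boolP [forall _ in _, _]) => [/forall_inP mx|]; last first.
  case/forall_inPn=> y yS /negPn lt_xy; rewrite mul0n big1 // => T _.
  case: ifP => // /lextP[bT _ _ mT].
  have := bT _ yS; have := mT _ _ xS yS lt_xy.
  by case: eqP => // ->; rewrite cS /= ltnS ltnNge => /negPf->.
rewrite mul1n; have lt_M : #|S :\ x| < M by rewrite -cS.
(* The inverse bijection: it gives [x] the label [#|S :\ x|], which is the top label for [S]. *)
pose h T : {ffun B -> 'I_M} :=
  [ffun y => if y == x then Ordinal lt_M else T y].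
have h_inj : {in lext (S :\ x) &, injective h}.
  move=> T1 T2 /lextP[_ o1 _ _] /lextP[_ o2 _ _] /ffunP eh.
  apply/ffunP => y; have := eh y; rewrite !ffunE; case: (eqVneq y x) => // ->.
  by rewrite o1 ?o2 // !inE eqxx.
rewrite -(card_in_imset h_inj).
rewrite -[RHS]sum1_card [RHS]big_mkcond; apply: eq_bigr => T _.
suff -> : (T \in h @: lext (S :\ x)) = (T \in lext S) && (T x == #|S|.-1 :> nat).
  by case: (T \in lext S) => //=; case: eqP.
apply/imsetP/andP => [[T' /lextP[bT oT iT mT] ->]|[/lextP[bT oT iT mT] /eqP Tx]].
  split; last by rewrite ffunE eqxx cS.
  apply/lextP; split.
  - move=> y yS; rewrite ffunE cS; case: (eqVneq y x) => [//|ne].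
    by apply: leqW; apply: bT; rewrite !inE ne.
  - move=> y yS; rewrite ffunE; case: eqP => [ey|_]; first by rewrite ey xS in yS.
    by apply: oT; rewrite !inE (negPf yS) andbF.
  - move=> y z yS zS; rewrite !ffunE.
    case: (eqVneq y x) => [->|ney]; case: (eqVneq z x) => [->|nez] //.
    + by move/(congr1 val) => /= e; have := bT z; rewrite !inE nez zS -e ltnn => /(_ isT).
    + by move/(congr1 val) => /= e; have := bT y; rewrite !inE ney yS e ltnn => /(_ isT).
    + by apply: iT; rewrite !inE ?ney ?nez.
  - move=> y z yS zS lt_yz; rewrite !ffunE.
    case: (eqVneq y x) => [ey|ney].
      by have := mx z zS; rewrite ey in lt_yz; rewrite lt_yz.
    case: (eqVneq z x) => [_|nez]; first by apply: bT; rewrite !inE ney.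
    by apply: mT; rewrite // !inE ?ney ?nez.
exists [ffun y => if y == x then d0 else T y].
  apply/lextP; split.
  - move=> y; rewrite !inE ffunE => /andP[ney yS]; rewrite (negPf ney).
    have := bT y yS; rewrite cS ltnS leq_eqVlt => /orP[/eqP Ty|//].
    case/eqP: ney; apply: iT => //; apply: val_inj.
    by rewrite /= Ty Tx cS.
  - move=> y; rewrite !inE ffunE; case: (eqVneq y x) => //= _; exact: oT.
  - move=> y z; rewrite !inE !ffunE => /andP[/negPf-> yS] /andP[/negPf-> zS].
    exact: iT.
  - move=> y z; rewrite !inE !ffunE => /andP[/negPf-> yS] /andP[/negPf-> zS].
    exact: mT.
apply/ffunP => y; rewrite !ffunE; case: (eqVneq y x) => // ->.
by apply: val_inj; rewrite /= Tx cS.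
Qed.

Lemma lext_rec S : #|S| <= M -> S != set0 ->
  #|lext S| = \sum_(x | maximal_in S x) #|lext (S :\ x)|.
Proof.
move=> le_SM S0; rewrite -sum1_card.
under eq_bigr => T TS do rewrite -(@lext_top S T TS S0).
rewrite exchange_big /=; under eq_bigr => x xS do rewrite lext_fiber //.
rewrite big_mkcond [RHS]big_mkcond; apply: eq_bigr => x _ /=.
by rewrite /maximal_in; case: (x \in S) => //=; case: forallP => _; rewrite ?mul1n.
Qed.

End LinearExtensions.

(** * Order ideals of the shape in diagonal coordinates *)

Section Shape.

Variables (n k : nat).
Implicit Types (x y : box n k) (s : seq nat).

Definition diag x := col_of x - row_of x.

Lemma row_ltn x : row_of x < n. Proof. exact: ltn_ord. Qed.

Lemma diag_ltn x : diag x < k.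
Proof. by have /andP[] := valP x; rewrite /diag /row_of /col_of; lia. Qed.

Lemma col_diag x : col_of x = row_of x + diag x.
Proof. by have /andP[] := valP x; rewrite /diag /row_of /col_of; lia. Qed.

Lemma box_inj x y : row_of x = row_of y -> diag x = diag y -> x = y.
Proof.
move=> er ed; have ec : col_of x = col_of y by rewrite !col_diag er ed.
apply: val_inj; rewrite (surjective_pairing (val x)) (surjective_pairing (val y)).
by congr pair; apply: val_inj.
Qed.

Lemma box_exists r j : r < n -> j < k -> {x | row_of x = r & diag x = j}.
Proof.
move=> lt_rn lt_jk; have lt_c : r + j < n + k by lia.
have in_rc : @in_shape n k (Ordinal lt_rn, Ordinal lt_c).
  by rewrite /in_shape /=; lia.
by exists (exist _ (Ordinal lt_rn, Ordinal lt_c) in_rc); rewrite /diag /row_of /col_of //= addKn.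
Qed.

Lemma card_box : #|{: box n k}| = n * k.
Proof.
pose f x : 'I_n * 'I_k := ((val x).1, Ordinal (diag_ltn x)).
have f_inj : injective f.
  by move=> x y [er ed]; apply: box_inj => //; rewrite /row_of er.
rewrite -(card_codom f_inj) -[n in RHS]card_ord -[k in RHS]card_ord -card_prod.
apply: eq_card => -[i j]; rewrite [RHS]inE.
have [x ex ey] := box_exists (ltn_ord i) (ltn_ord j).
by apply/codomP; exists x; congr pair; apply: val_inj.
Qed.

Definition box_lt x y :=
  (row_of x == row_of y) && (col_of x < col_of y) ||
  (col_of x == col_of y) && (row_of x < row_of y).

(** Surjectivity comes for free from injectivity, since there are as many boxes as labels. *)
Lemma syt_lext (d0 : 'I_(n * k)) : syt n k = lext box_lt d0 setT.
Proof.
apply/setP => T; rewrite inE.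
apply/and3P/lextP => [[/andP[/injectiveP iT _] rT cT]|[_ _ iT mT]].
  split=> [x _|x||x y _ _]; rewrite ?inE //; first by rewrite cardsT card_box.
    by move=> x y _ _; apply: iT.
  case/orP; first by have /forallP/(_ y)/implyP := forallP rT x; apply.
  by have /forallP/(_ y)/implyP := forallP cT x; apply.
have {}iT : injective T by move=> x y; apply: iT.
split; last 2 first.
- apply/forallP => x; apply/forallP => y; apply/implyP => lt_xy.
  by apply: mT; rewrite ?inE // /box_lt lt_xy.
- apply/forallP => x; apply/forallP => y; apply/implyP => lt_xy.
  by apply: mT; rewrite ?inE // /box_lt lt_xy orbT.
apply/andP; split; first exact/injectiveP.
apply/forallP => l; have : l \in codom T.
  by apply: inj_card_onto iT _ l; rewrite card_box card_ord.
by case/codomP => x ->; apply/existsP; exists x.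
Qed.

Definition ideal s : {set box n k} := [set x | row_of x < nth 0 s (diag x)].

(** The box in row r on diagonal j+1 has the box in row r on diagonal j to its left and the box in
    row r+1 on diagonal j below it. Closure under these two relations gives the two inequalities. *)
Definition ideal_shape s :=
  [/\ size s = k, nth 0 s 0 <= n
    & forall j, j.+1 < k -> nth 0 s j.+1 <= nth 0 s j <= (nth 0 s j.+1).+1].

Lemma ideal_shape_le s i d : ideal_shape s -> i + d < k ->
  nth 0 s (i + d) <= nth 0 s i <= nth 0 s (i + d) + d.
Proof.
case=> _ _ hs; elim: d => [|d IHd]; first by rewrite !addn0 leqnn.
by rewrite addnS => h; have := hs _ h; have := IHd (ltnW h); lia.
Qed.

(* At the ends j = k - 1 and j = 0 the conditions read 0 < s_j (default value of
   nth) and s_0 <= s_0 (0.-1 = 0). *)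
Definition removable s j :=
  (nth 0 s j.+1 < nth 0 s j) && (nth 0 s j.-1 <= nth 0 s j).

(* For k = 1 the diagonal is an antichain, not a chain. *)
Hypothesis k_gt1 : 1 < k.

(** The two conditions in [removable] say that the right and lower neighbours of the last box on the
    diagonal are absent. Farther boxes of its row and column are excluded through
    [ideal_shape_le]. *)
Lemma maximal_ideal s x : ideal_shape s ->
  maximal_in box_lt (ideal s) x =
  ((row_of x).+1 == nth 0 s (diag x)) && removable s (diag x).
Proof.
move=> hs; have [ss s0 sS] := hs; have lt_jk := diag_ltn x.
have le_n j : j < k -> nth 0 s j <= n.
  by move=> jk; have := @ideal_shape_le s 0 j hs jk; rewrite add0n; lia.
apply/andP/and3P => [[xS /forall_inP mx]|[/eqP rx down up]]; last first.
  have xS : x \in ideal s by rewrite inE -rx.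
  split=> //; apply/forall_inP => y; rewrite inE => yS.
  rewrite /box_lt !col_diag; apply/negP.
  have lt_yk := diag_ltn y.
  case/orP=> /andP[/eqP e lt_xy].
    have lt_d : (diag x).+1 + (diag y - (diag x).+1) < k by lia.
    have := ideal_shape_le hs lt_d.
    have -> : (diag x).+1 + (diag y - (diag x).+1) = diag y by lia.
    lia.
  (* Going down a column lowers the diagonal by one per row, which matches the slope bound in
     [ideal_shape_le]. *)
  have lt_d : diag y + ((diag x).-1 - diag y) < k by lia.
  have := ideal_shape_le hs lt_d.
  have -> : diag y + ((diag x).-1 - diag y) = (diag x).-1 by lia.
  lia.
have {}mx r j : r < n -> j < k ->
    [|| (r == row_of x) && (diag x < j)
      | (r + j == row_of x + diag x) && (row_of x < r)] -> nth 0 s j <= r.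
  move=> rn jk; have [y <- <-] := box_exists rn jk => h.
  rewrite leqNgt; apply/negP => yS.
  have := mx y; rewrite inE yS => /(_ isT)/negP; apply.
  rewrite /box_lt !col_diag.
  by case/orP: h => /andP[/eqP e lt_xy]; apply/orP; [left|right]; apply/andP; split; lia.
move: xS; rewrite inE => xS; have lt_rn := row_ltn x.
have next : (diag x).+1 < k -> nth 0 s (diag x).+1 <= row_of x.
  by move=> h; apply: (mx (row_of x)) => //; lia.
have prev : 0 < diag x -> (row_of x).+1 < n -> nth 0 s (diag x).-1 <= (row_of x).+1.
  by move=> d0 h; apply: mx; lia.
(* Boxes of one diagonal are incomparable under [box_lt], so this needs a neighbouring diagonal: the
   next one if it exists, otherwise the previous one, which exists because [1 < k]. *)
have rx : (row_of x).+1 = nth 0 s (diag x).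
  have := le_n _ lt_jk; have [h|h] := ltnP (diag x).+1 k.
    by have := sS _ h; have := next h; lia.
  have h' : (diag x).-1.+1 < k by lia.
  have := sS _ h'; rewrite prednK; last by lia.
  by have := prev; lia.
split; first by rewrite rx.
  have [h|h] := ltnP (diag x).+1 k; first by rewrite -rx ltnS next.
  by rewrite (nth_default 0 (n := _.+1)) ?ss // -rx.
case: (posnP (diag x)) => [-> //|d0].
have [h|h] := ltnP (row_of x).+1 n; first by rewrite -rx prev.
by rewrite -rx; apply: leq_trans h; apply: le_n; lia.
Qed.

Definition remove s j := set_nth 0 s j (nth 0 s j).-1.

Lemma idealD1 s x : (row_of x).+1 = nth 0 s (diag x) ->
  ideal s :\ x = ideal (remove s (diag x)).
Proof.
move=> rx; apply/setP => y; rewrite !inE nth_set_nth /=.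
case: (eqVneq (diag y) (diag x)) => [ed|ned]; last first.
  by case: eqVneq => //= e; rewrite e eqxx in ned.
rewrite ed -rx /= ltnS; case: (eqVneq y x) => [->|neq] /=.
  by rewrite ltnn.
rewrite leq_eqVlt; case: eqP => //= er.
by case/eqP: neq; apply: box_inj.
Qed.

Variable d0 : 'I_(n * k).

Definition num_lext s := #|lext box_lt d0 (ideal s)|.

Lemma num_lext0 : num_lext (nseq k 0) = 1.
Proof.
rewrite /num_lext (_ : ideal _ = set0) ?lext_set0 //.
by apply/setP => x; rewrite !inE nth_nseq diag_ltn.
Qed.

Lemma num_lext_full : num_lext (nseq k n) = g n k.
Proof.
rewrite /g (syt_lext d0) /num_lext (_ : ideal _ = setT) //.
by apply/setP => x; rewrite !inE nth_nseq diag_ltn row_ltn.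
Qed.

Lemma num_lext_rec s : ideal_shape s -> 0 < nth 0 s 0 ->
  num_lext s = \sum_(j < k) removable s j * num_lext (remove s j).
Proof.
move=> hs s0; have [ss s0n sS] := hs; rewrite /num_lext lext_rec; last first.
- have [x rx dx] := box_exists (leq_trans s0 s0n) (ltnW k_gt1).
  by apply/set0Pn; exists x; rewrite inE rx dx.
- by rewrite -card_box max_card.
(* Each diagonal carries at most one maximal box, its last one. *)
rewrite (partition_big (fun x => Ordinal (diag_ltn x)) predT) //=.
apply: eq_bigr => j _.
under eq_bigl => x do rewrite (maximal_ideal _ hs).
case: (boolP (removable s j)) => [rj|/negPf rj]; last first.
  rewrite mul0n big_pred0 // => x.
  apply/negP => /andP[/andP[_ rx] /eqP/(congr1 val)/= dx].
  by rewrite -dx rx in rj.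
have sj_gt0 : 0 < nth 0 s j by case/andP: rj => + _; apply: leq_ltn_trans.
have sj_le : (nth 0 s j).-1 < n.
  by have := @ideal_shape_le s 0 j hs (ltn_ord j); rewrite add0n; lia.
have [x rx dx] := box_exists sj_le (ltn_ord j).
rewrite mul1n (big_pred1 x) => [|y].
  by rewrite idealD1 dx // rx prednK.
apply/idP/eqP => [/andP[/andP[/eqP ry _] /eqP/(congr1 val)/= dy]|->].
  by apply: box_inj; rewrite ?dx // rx -dy -ry.
have -> : Ordinal (diag_ltn x) = j by apply: val_inj.
by rewrite dx rj rx prednK // !eqxx.
Qed.

End Shape.

Lemma pellSS m : pell m.+2 = 2 * pell m.+1 + pell m. Proof. by []. Qed.

(** * The recursion for four diagonals and its solution by Pell numbers *)

Section FourBoxes.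

Local Arguments pell : simpl never.

Variables (n : nat) (d0 : 'I_(n * 4)).

Local Notation E s := (num_lext (k := 4) d0 s).

Lemma num_lext_rec4 a b c d : 0 < a <= n ->
  [&& b <= a <= b.+1, c <= b <= c.+1 & d <= c <= d.+1] ->
  E [:: a; b; c; d] =
    (b < a) * E [:: a.-1; b; c; d]
    + ((c < b) && (a <= b)) * E [:: a; b.-1; c; d]
    + ((d < c) && (b <= c)) * E [:: a; b; c.-1; d]
    + ((0 < d) && (c <= d)) * E [:: a; b; c; d.-1].
Proof.
move=> /andP[a0 an] /and3P[hab hbc hcd].
rewrite num_lext_rec //; last by split=> // -[|[|[|j]]].
by rewrite !big_ord_recl big_ord0 /removable /remove /= leqnn andbT addn0 !addnA.
Qed.

Local Ltac step := rewrite num_lext_rec4 ?ltnS /=; try lia;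
  rewrite ?(ltnSn, ltnn, leqnn, leqnSn, ltn0, leq0n, andbF, andbT, andbb) /=
    ?(mul0n, mul1n, addn0, add0n).

(** Both families are carried through one induction because each feeds the other. The bounds on [n]
    only make the vectors fit into the shape; the values do not depend on [n]. *)
Lemma num_lext_period k :
  (k.+1 <= n -> E [:: k.+1; k.+1; k.+1; k.+1] = pell k.*2.+1) /\
  (k.+2 <= n -> E [:: k.+2; k.+1; k.+1; k] = pell k.*2.+2).
Proof.
have E0 : E [:: 0; 0; 0; 0] = 1 := num_lext0 d0.
elim: k => [|k [IHx IHy]].
  split=> hn; first by do 4!step.
  have E1100 : E [:: 1; 1; 0; 0] = 1 by do 2!step.
  have E1110 : E [:: 1; 1; 1; 0] = 1 by step.
  have E2100 : E [:: 2; 1; 0; 0] = 1 by step.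
  by step; rewrite E1110 E2100.
(* The digits in these names are the entries minus [k]. Here one path leads to [IHx] and two lead to
   [IHy]. *)
have E2211 : k.+2 <= n -> E [:: k.+2; k.+2; k.+1; k.+1] = pell k.*2.+3.
  move=> hn; step; have -> : E [:: k.+2; k.+2; k.+1; k] = pell k.*2.+2.
    by step; rewrite IHy.
  by step; rewrite IHx ?IHy ?(ltnW hn) // [RHS]pellSS; lia.
have E2221 : k.+2 <= n -> E [:: k.+2; k.+2; k.+2; k.+1] = pell k.*2.+3.
  by move=> hn; step; rewrite E2211.
rewrite doubleS; split=> hn; first by step; rewrite E2221.
have E3210 : E [:: k.+3; k.+2; k.+1; k] = pell k.*2.+2.
  by do 2!step; rewrite IHy // ltnW.
have E3211 : E [:: k.+3; k.+2; k.+1; k.+1] = pell k.*2.+3 + pell k.*2.+2.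
  by step; rewrite E2211 ?E3210 // ltnW.
by step; rewrite E2221 ?E3211 ?(ltnW hn) // [RHS]pellSS; lia.
Qed.

End FourBoxes.

Lemma g4_pell n : g n.+1 4 = pell n.*2.+1.
Proof.
pose d0 : 'I_(n.+1 * 4) := ord0.
by rewrite -(num_lext_full d0) (num_lext_period d0 n).1.
Qed.

Theorem theorem2 :
  (forall n : nat, (1 <= n)%N -> g n 4 = pell (2 * n - 1)) /\
  (forall n : nat, (3 <= n)%N ->
     ((g n 4)%:Z = 6 * (g (n - 1) 4)%:Z - (g (n - 2) 4)%:Z)%R) /\
  g 1 4 = 1%N /\
  g 2 4 = 5%N.
Proof.
split; first by case=> // n _; rewrite g4_pell mul2n doubleS subn1.
split; last by rewrite !g4_pell.
(* Everything is now linear in [pell n.*2.+1] and [pell n.*2], and the claim is the identity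
   $P_{m+4}=6P_{m+2}-P_m$ for $m=2n+1$. *)
case=> [|[|[|n]]] // _; rewrite subSS subn0 !subSS subn0 !g4_pell !doubleS !pellSS.
lia.
Qed.
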